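(* For every $f\in\ell_\infty^{\rm loc}(\mathbb R^d)$ the two-sided inequality $$|f|_{V_p^k}\approx\sup_{\pi\in\Pi}\Big\{\sum_{Q\in\pi}\operatorname{osc}_k(f;Q)^p\Big\}^{1/p}$$ holds with constants of equivalence depending only on $k,d$.
   Context: Fix $d,k\in\mathbb N$, $1\le p<\infty$, and let $Q^d:=[0,1]^d$. $\ell_\infty^{\rm loc}(\mathbb R^d)$ is the set of functions $f:\mathbb R^d\to\mathbb R$ bounded on every compact set. A cube is a closed cube in $\mathbb R^d$ homothetic to $Q^d$. A packing is a family of cubes with pairwise disjoint interiors; $\Pi$ is the set of finite packings consisting of cubes contained in $Q^d$. $\mathcal P_{k-1}^d$ is the space of real polynomials on $\mathbb R^d$ of degree at most $k-1$. For a cube $Q$, $E_k(f;Q):=\inf_{m\in\mathcal P_{k-1}^d}\sup_Q|f-m|$, and $$|f|_{V_p^k}:=\sup_{\pi\in\Pi}\Big(\sum_{Q\in\pi}E_k(f;Q)^p\Big)^{1/p}\in[0,\infty].$$ With $\Delta_h^kf:=\sum_{j=0}^k(-1)^{k-j}\binom kj f(\cdot+jh)$, put $$\operatorname{osc}_k(f;Q):=\sup_{h\in\mathbb R^d}\{|\Delta_h^kf(x)|:\ x+jh\in Q,\ j=0,\dots,k\}.$$ $A\approx B$ means $c_1A\le B\le c_2A$ with positive constants $c_1,c_2$ (here depending only on $k,d$). *)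

(* Defs.v *)
From mathcomp Require Import all_boot all_order all_algebra.
From mathcomp Require Import all_classical all_reals all_analysis.
From mathcomp Require Import -(notations) mpoly.
Set Implicit Arguments.
Unset Strict Implicit.
Unset Printing Implicit Defensive.
Import Order.TTheory GRing.Theory Num.Theory numFieldNormedType.Exports.
Local Open Scope classical_set_scope.
Local Open Scope ring_scope.

Section LocalPolynomialApproximation.
Context {R : realType} {d : nat}.
Implicit Types (f : 'rV[R]_d -> R) (Q : set 'rV[R]_d) (k : nat) (p : R).

Definition locally_bounded f : Prop :=
  forall K : set 'rV[R]_d, compact K -> [bounded f x | x in K].

Definition unit_cube : set 'rV[R]_d := [set x | forall i, 0 <= x 0 i <= 1].

Definition is_cube Q : Prop :=
  exists (a : 'rV[R]_d) (s : R),
    0 < s /\ Q = [set a + s *: x | x in unit_cube].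

Definition packing (P : set (set 'rV[R]_d)) : Prop :=
  (forall Q, P Q -> is_cube Q) /\ trivIset P (fun Q => Q°).

Definition unit_packings : set (set (set 'rV[R]_d)) :=
  [set P | [/\ finite_set P, packing P & forall Q, P Q -> Q `<=` unit_cube]].

Definition peval (m : mpoly d R) (x : 'rV[R]_d) : R :=
  meval (fun i => x 0 i) m.

(* [msize m] is the total degree of [m] plus one (and 0 for the zero
   polynomial), so this is the space of polynomials of degree at most
   [k - 1]. *)
Definition polys_lt k : set (mpoly d R) :=
  [set m | (msize m <= k)%N].

(* The suprema and infima below are taken in [\bar R], so that they are
   meaningful without any boundedness assumption. *)
Definition best_approx k f Q : \bar R :=
  ereal_inf [set ereal_sup [set `|f x - peval m x|%:E | x in Q]
            | m in polys_lt k].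

Definition finite_difference k (h : 'rV[R]_d) f (x : 'rV[R]_d) : R :=
  \sum_(j < k.+1) (-1) ^+ (k - j) * 'C(k, j)%:R * f (x + j%:R *: h).

Definition osc k f Q : \bar R :=
  ereal_sup [set `|finite_difference k hx.1 f hx.2|%:E
            | hx in [set hx : 'rV[R]_d * 'rV[R]_d |
                     forall j, (j <= k)%N -> Q (hx.2 + j%:R *: hx.1)]].

Definition packing_sup p (omega : set 'rV[R]_d -> \bar R) : \bar R :=
  ereal_sup [set ((\sum_(Q \in P) omega Q `^ p) `^ p^-1)%E
            | P in unit_packings].

Definition variation_seminorm k p f : \bar R :=
  packing_sup p (best_approx k f).

End LocalPolynomialApproximation.

(* Main.v *)
Require Import Defs.
From mathcomp Require Import all_boot all_order all_algebra.
From mathcomp Require Import all_classical all_reals all_analysis.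
From mathcomp Require Import ring lra zify.
From mathcomp Require Import -(notations) mpoly.
Set Implicit Arguments.
Unset Strict Implicit.
Unset Printing Implicit Defensive.
Import Order.TTheory GRing.Theory Num.Theory numFieldNormedType.Exports.
Local Open Scope classical_set_scope.
Local Open Scope ring_scope.

(** The equivalence of the two suprema comes from an equivalence of the two
    set functions on every single cube, with constants independent of the
    cube.

    One half is elementary: [Delta_h^k] kills polynomials of degree less than
    [k] and has operator norm at most [2 ^ k], so [osc_k <= 2 ^ k * E_k]
    ([osc_le_best_approx]).

    The other half is a Whitney inequality [E_k(f; Q) <= C * osc_k(f; Q)] for
    functions that are merely bounded, so that no averaging of [f] is
    available ([whitney]).  Write [e] for the oscillation.  The argument has
    three ingredients.

    - Polynomial part.  By a combinatorial identity of Djokovic, a difference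
      with any [n >= k] steps taken along different directions is a
      combination of pure differences [Delta_y^k], so it is [O(e)] near the
      centre of [Q] ([mixed_diff_le_pure]).  Newton's forward formula writes
      the values of [f] on a small central box of nodes through mixed
      differences along the axes; dropping those with at least [k] steps
      leaves a polynomial [m] of total degree less than [k] that is [O(e)]
      close to [f] at the nodes ([newton_truncated]).

    - One variable.  Let [phi] be bounded by [B] on the unit interval with
      [|Delta_h^k phi| <= e].  Differences of lower order with a small step
      are at most [delta * B + C_delta * e], since a difference that varies
      slowly and telescopes to a bounded quantity has to be small
      ([small_lower_diff]).  If moreover [phi] is small at [k] consecutive
      nodes of a fine grid, the recurrence [Delta^k phi = O(e)] makes it
      small on the whole grid, and between grid points it moves by at most
      [B / 2 + C * e].  Taking for [B] the supremum of [|phi|] absorbs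
      [B / 2] and bounds [phi] by [O(e)] ([bound_on_interval]).

    - Several variables.  The one-variable bound applied to [f - m] along the
      coordinate directions, one direction after the other, spreads the
      smallness from the box of nodes to all of [Q] ([bound_on_cube]). *)

(** * Iterated differences *)

Section MixedDifferences.
Context {R : realType}.

Fixpoint mixed_diff (V : zmodType) (hs : seq V) (f : V -> R) (x : V) : R :=
  if hs is h :: hs' then mixed_diff hs' f (x + h) - mixed_diff hs' f x
  else f x.

Lemma mixed_diff_cat (V : zmodType) (hs gs : seq V) (f : V -> R) x :
  mixed_diff (hs ++ gs) f x = mixed_diff hs (mixed_diff gs f) x.
Proof. by elim: hs x => //= h hs IH x; rewrite !IH. Qed.

Lemma eq_mixed_diff (V : zmodType) (hs : seq V) (f g : V -> R) x :
  f =1 g -> mixed_diff hs f x = mixed_diff hs g x.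
Proof. by move=> fg; elim: hs x => //= h hs IH x; rewrite !IH. Qed.

Lemma mixed_diff_comp (V W : zmodType) (L l : V -> W)
    (hs : seq V) (f : W -> R) x :
  (forall y h, L (y + h) = L y + l h) ->
  mixed_diff hs (f \o L) x = mixed_diff (map l hs) f (L x).
Proof. by move=> Lh; elim: hs x => //= h hs IH x; rewrite !IH Lh. Qed.

Lemma mixed_diffB (V : zmodType) (hs : seq V) (f g : V -> R) x :
  mixed_diff hs (fun y => f y - g y) x = mixed_diff hs f x - mixed_diff hs g x.
Proof. by elim: hs x => //= h hs IH x; rewrite !IH; ring. Qed.

Lemma mixed_diffZ (V : zmodType) (hs : seq V) c (f : V -> R) x :
  mixed_diff hs (fun y => c * f y) x = c * mixed_diff hs f x.
Proof. by elim: hs x => //= h hs IH x; rewrite !IH; ring. Qed.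

Lemma mixed_diff_sum (V : zmodType) (hs : seq V) (I : Type) (r : seq I)
    (f : I -> V -> R) x :
  mixed_diff hs (fun y => \sum_(i <- r) f i y) x =
  \sum_(i <- r) mixed_diff hs (f i) x.
Proof.
by elim: hs x => //= h hs IH x; rewrite !IH -sumrB.
Qed.

Lemma mixed_diff_zero_step (V : zmodType) (hs : seq V) (f : V -> R) x :
  0 \in hs -> mixed_diff hs f x = 0.
Proof.
elim: hs x => //= h hs IH x; rewrite in_cons => /orP[/eqP <-|h0].
  by rewrite addr0 subrr.
by rewrite !IH // subrr.
Qed.

Lemma mixed_diff_nseqE (V : zmodType) k (h : V) (f : V -> R) x :
  mixed_diff (nseq k h) f x =
  \sum_(j < k.+1) (-1) ^+ (k - j) * 'C(k, j)%:R * f (x + h *+ j).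
Proof.
elim: k x => [|k IH] x /=.
  by rewrite big_ord_recl big_ord0 /= bin0 subnn expr0 mulr0n !addr0 !mul1r.
rewrite !IH [in RHS]big_ord_recl /= [X in X - _ = _]big_ord_recr /=.
rewrite [in RHS]big_ord_recr /= big_ord_recl /=.
rewrite !bin0 !subn0 !mulr0n !addr0 !subnn !binn !expr0 !mulr1.
rewrite /bump /= !add1n.
have -> : \sum_(i < k) (-1) ^+ (k.+1 - bump 0 i) * 'C(k.+1, bump 0 i)%:R *
     f (x + h *+ bump 0 i) =
   \sum_(i < k) (-1) ^+ (k - i) * 'C(k, i)%:R * f (x + h + h *+ i) -
   \sum_(i < k) (-1) ^+ (k - bump 0 i) * 'C(k, bump 0 i)%:R *
     f (x + h *+ bump 0 i).
  rewrite -sumrB; apply: eq_bigr => i _.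
  have -> : x + h + h *+ i = x + h *+ i.+1 by rewrite mulrS addrA.
  rewrite /bump /= !add1n subSS binS natrD.
  by rewrite -(subnSK (ltn_ord i)) exprS; ring.
have -> : x + h + h *+ k = x + h *+ k.+1 by rewrite mulrS addrA.
by rewrite exprS; ring.
Qed.

Lemma mixed_diff_bound (V : zmodType) k (h : V) (f : V -> R) x (B : R) :
  (forall j, (j <= k)%N -> `|f (x + h *+ j)| <= B) ->
  `|mixed_diff (nseq k h) f x| <= 2 ^+ k * B.
Proof.
elim: k x => [|k IH] x fB /=.
  by have := fB 0%N isT; rewrite mulr0n addr0 mul1r.
rewrite exprS -mulrA mulrDl mul1r (le_trans (ler_normB _ _))// lerD//;
  apply: IH.
  by move=> j jk; rewrite -addrA -mulrS; exact: fB.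
by move=> j jk; apply: fB; rewrite (leq_trans jk).
Qed.

(** The Leibniz rule when one factor is affine along [h]: only two terms
    survive.  It lets degrees of monomials be counted one variable at a
    time. *)
Lemma mixed_diff_nseq_mul_affine (V : zmodType) k (h : V) (l f : V -> R) c x :
  (forall y, l (y + h) = l y + c) ->
  mixed_diff (nseq k.+1 h) (fun y => l y * f y) x =
  l x * mixed_diff (nseq k.+1 h) f x +
  k.+1%:R * c * mixed_diff (nseq k h) f (x + h).
Proof.
move=> lh; elim: k x => [|k IH] x.
  by rewrite /= lh; ring.
have E g y : mixed_diff (nseq k.+2 h) g y =
   mixed_diff (nseq k.+1 h) g (y + h) - mixed_diff (nseq k.+1 h) g y by [].
rewrite !E !IH lh.
by rewrite [mixed_diff (nseq k.+1 h) f (x + h)]/= -[k.+2%:R]natr1; ring.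
Qed.

End MixedDifferences.

(** * From pure to mixed differences *)

Section PureToMixed.
Context {R : realType} {V : normedModType R}.
Variables (k : nat) (f : V -> R) (c : V) (r e : R).

(** Each step [h] carries a weight [w].  The mixed difference taken with the
    steps [(1 - i * w) *: h] is averaged over [i] with the coefficients of
    [Delta^k], while the base point moves by [y *+ i]. *)
Let skew (l : seq (V * R)) (x y : V) : R :=
  \sum_(i < k.+1) (-1) ^+ (k - i) * 'C(k, i)%:R *
    mixed_diff [seq (1 - i%:R * hw.2) *: hw.1 | hw <- l] f (x + y *+ i).

(* The shift [(1 - i w) h] at [x + i y] splits as [x + h] and [i (y - w h)]:
   removing one step from the list keeps the shape of the sum. *)
Let skew_cons h w l x y :
  skew ((h, w) :: l) x y = skew l (x + h) (y - w *: h) - skew l x y.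
Proof.
rewrite /skew -sumrB; apply: eq_bigr => i _ /=; rewrite -mulrBr.
congr (_ * (mixed_diff _ _ _ - _)).
rewrite mulrnBl scalerBl scale1r -scalerA scaler_nat -!addrA; congr (_ + _).
by rewrite addrCA.
Qed.

Hypothesis fe : forall x y, `|x - c| + k%:R * `|y| <= r ->
  `|mixed_diff (nseq k y) f x| <= e.

Let skew_bound l x y :
  all (fun hw : V * R => 0 <= hw.2 <= 1) l ->
  `|x - c| + k%:R * `|y| + k.+1%:R * (\sum_(hw <- l) `|hw.1|) <= r ->
  `|skew l x y| <= 2 ^+ size l * e.
Proof.
elim: l x y => [|[h w] l IH] x y /=.
  rewrite big_nil mulr0 addr0 mul1r => _ /fe.
  by rewrite mixed_diff_nseqE.
rewrite big_cons /= => /andP[/andP[w0 w1] lw] xyr.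
rewrite skew_cons exprS -mulrA mulrDl mul1r (le_trans (ler_normB _ _))//.
have k0 : 0 <= k%:R :> R by [].
have kS : k.+1%:R = k%:R + 1 :> R by rewrite natr1.
apply: lerD; apply: IH => //; apply: le_trans xyr; last first.
  by rewrite lerD2l ler_wpM2l// lerDr.
have h1 : `|x + h - c| <= `|x - c| + `|h|.
  by rewrite addrAC ler_normD.
have h2 : `|y - w *: h| <= `|y| + `|h|.
  rewrite (le_trans (ler_normB _ _))// lerD2l normrZ ger0_norm//.
  by rewrite ler_piMl.
have h3 := ler_wpM2l k0 h2.
by rewrite mulrDr addrA lerD2r kS mulrDl mul1r; lra.
Qed.

(** Djokovic's trick.  With weights [1 / (j + 1)] the [i]-th summand of [skew]
    for [1 <= i <= k] contains a zero step, hence vanishes, and the summand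
    [i = 0] is the mixed difference itself.  Peeling off the steps one by one
    instead turns [skew] into [2 ^ size hs] pure differences of order [k]. The
    room condition on [r] keeps all the points that occur in the ball where
    [f] is controlled. *)
Lemma mixed_diff_le_pure (hs : seq V) :
  (0 < k)%N -> (k <= size hs)%N -> k.+1%:R * (\sum_(h <- hs) `|h|) <= r ->
  `|mixed_diff hs f c| <= 2 ^+ size hs * e.
Proof.
move=> k0 khs hr.
pose ws : seq R := mkseq (fun j => j.+1%:R^-1) (size hs).
have sz : size ws = size hs by rewrite size_mkseq.
pose l := zip hs ws.
have szl : size l = size hs by rewrite size_zip sz minnn.
have lhs : unzip1 l = hs by rewrite unzip1_zip ?sz.
have lw : all (fun hw : V * R => 0 <= hw.2 <= 1) l.
  have /allP ww : all (fun w : R => 0 <= w <= 1) ws.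
    apply/allP => _ /mapP[j _ ->]; rewrite invr_ge0 ler0n/=.
    by rewrite invf_le1 ?ltr0n// ler1n.
  apply/allP => hw hwl; apply: ww.
  by rewrite -(unzip2_zip (s := hs) (t := ws)) ?sz//; apply: map_f.
have := @skew_bound l c 0 lw.
rewrite subrr !normr0 mulr0 !add0r.
rewrite -[X in \sum_(h <- X) _]lhs big_map in hr => /(_ hr).
rewrite szl /skew big_ord_recl big1 ?addr0 => [|i _]; last first.
  rewrite mixed_diff_zero_step ?mulr0//.
  apply/mapP; exists (nth 0 hs i, nth 0 ws i).
    have il : (i < size l)%N by rewrite szl (leq_trans _ khs).
    by rewrite -nth_zip ?sz// mem_nth.
  rewrite /= nth_mkseq ?(leq_trans _ khs)//.
  by rewrite /bump add1n divff ?subrr ?scale0r// pnatr_eq0.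
rewrite /= bin0 mulr1 normrM normrX normrN1 expr1n mul1r.
congr (`|mixed_diff _ _ _| <= _).
rewrite -[RHS]lhs /unzip1; apply: eq_map => hw.
by rewrite mul0r subr0 scale1r.
Qed.

End PureToMixed.

(** * Small differences of lower order in one variable *)

Section OneVariable.
Context {R : realType}.
Implicit Types (phi : R -> R).

(** The [n] increments that follow one another add up to [u n - u 0] and
    differ pairwise by at most [n * e]. *)
Lemma increment_bound (u : nat -> R) n (A e : R) :
  (0 < n)%N -> `|u 0%N| <= A -> `|u n| <= A ->
  (forall i, (i < n)%N -> `|(u i.+2 - u i.+1) - (u i.+1 - u i)| <= e) ->
  forall i, (i <= n)%N -> `|u i.+1 - u i| <= 2 * A / n%:R + n%:R * e.
Proof.
move=> n0 u0 un ue i i_n; pose v i := u i.+1 - u i.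
have e0 : 0 <= e by apply: le_trans (ue 0%N n0).
have v_up a b : (a + b <= n)%N -> `|v (a + b)%N - v a| <= b%:R * e.
  elim: b => [|b IH] abn; first by rewrite addn0 subrr normr0 mul0r.
  have := IH (leq_trans (leq_add (leqnn a) (leqnSn b)) abn).
  rewrite addnS in abn; have := ue _ abn.
  rewrite -/(v (a + b).+1) -/(v (a + b)%N) -natr1 mulrDl mul1r => h1 h2.
  rewrite addnS (_ : _ - v a = (v (a + b).+1 - v (a + b)%N) +
    (v (a + b)%N - v a)); last by ring.
  by rewrite addrC (le_trans (ler_normD _ _))// lerD.
have v_close a b : (a <= b)%N -> (b <= n)%N -> `|v b - v a| <= n%:R * e.
  move=> ab bn; have := @v_up a (b - a)%N; rewrite subnKC// => /(_ bn).
  move/le_trans; apply; rewrite ler_wpM2r// ler_nat.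
  by rewrite (leq_trans (leq_subr _ _)).
have vv m : (m < n)%N -> `|v i - v m| <= n%:R * e.
  move=> mn; have [mi|im] := leqP m i; first exact: v_close.
  by rewrite distrC v_close// ltnW.
have n0R : 0 < n%:R :> R by rewrite ltr0n.
have E : n%:R * v i = (u n - u 0%N) + \sum_(m < n) (v i - v m).
  rewrite sumrB sumr_const card_ord -mulr_natl.
  rewrite -(big_mkord predT) /v telescope_sumr//; ring.
rewrite -(ler_pM2l n0R) mulrDr -{1}(gtr0_norm n0R) -normrM E.
rewrite (le_trans (ler_normD _ _))// lerD//.
  rewrite mulrC divfK ?gt_eqF// mulr_natl mulr2n.
  by rewrite (le_trans (ler_normB _ _))// lerD.
rewrite (le_trans (ler_norm_sum _ _ _))//.
rewrite (le_trans (ler_sum _ (fun (m : 'I_n) _ => vv m (ltn_ord m))))//.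
by rewrite sumr_const card_ord -[leLHS]mulr_natl.
Qed.

Definition diff_le_on01 k phi (e : R) :=
  forall x h, 0 <= x -> 0 <= h -> x + h *+ k <= 1 ->
    `|mixed_diff (nseq k h) phi x| <= e.

(** Downward induction on the order: [increment_bound], applied to a
    difference of order [j] along a progression of length [n], trades the
    smallness of order [j + 2] for that of order [j + 1], with a gain
    [1 / n] in front of [B].  Here [m = k - (j + 1)] counts the descents, and
    the constants depend only on [k], [j] and [dl]. *)
Lemma small_lower_diff k m j (dl : R) : (j.+1 + m)%N = k -> 0 < dl ->
  exists h0 C : R, [/\ 0 < h0, 0 <= C &
  forall phi B e, (forall x, 0 <= x <= 1 -> `|phi x| <= B) ->
    diff_le_on01 k phi e ->
    forall x h, 0 <= x -> 0 <= h <= h0 -> x + h *+ j.+1 <= 1 ->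
    `|mixed_diff (nseq j.+1 h) phi x| <= dl * B + C * e].
Proof.
elim: m j dl => [|m IH] j dl jmk dl0.
  exists 1, 1; split => // phi B e phiB phie x h x0 /andP[h0 _] xh.
  have B0 : 0 <= B by apply: le_trans (phiB 0 _); rewrite ?lexx ?ler01.
  rewrite addn0 in jmk; rewrite jmk mul1r ler_wpDl//; first by nra.
  by apply: phie; rewrite // -jmk.
(* [n] makes the telescoping term at most [dl / 2 * B]; the order above is
   then used with [dl / (2 n)] because its bound gets multiplied by [n]. *)
pose n := (Num.truncn (2 ^+ j.+2 / dl)).+1.
have n0 : 0 < n%:R :> R by rewrite ltr0n.
have ndl : 2 ^+ j.+2 <= dl * n%:R.
  rewrite mulrC -ler_pdivrMr// ltW// truncnS_gt//.
have dl'0 : 0 < dl / (2 * n%:R) by rewrite divr_gt0// mulr_gt0.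
have [|h0 [C [h00 C0 H]]] := IH j.+1 _ _ dl'0; first by rewrite -jmk addnS.
exists (Num.min h0 (2 * (n + j.+1)%:R)^-1), (n%:R * C); split.
- by rewrite lt_min h00 invr_gt0 mulr_gt0.
- by rewrite mulr_ge0// ltW.
move=> phi B e phiB phie x h x0 /andP[hge0]; rewrite le_min => /andP[hh0 hn] xh.
have B0 : 0 <= B by apply: le_trans (phiB 0 _); rewrite ?lexx ?ler01.
have hn2 : h *+ (n + j.+1) <= 2^-1.
  rewrite -[h *+ _]mulr_natr.
  by rewrite -ler_pdivlMr ?ltr0n// -invfM.
have hmono a b : (a <= b)%N -> h *+ a <= h *+ b by move=> ab; exact: ler_wpMn2l.
have hn0 a : 0 <= h *+ a by rewrite mulrn_wge0.
have key y i : 0 <= y -> y + h *+ (n + j.+1) <= 1 -> (i <= n)%N ->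
    `|mixed_diff (nseq j.+1 h) phi (y + h *+ i)| <= dl * B + n%:R * C * e.
  move=> y0 yh i_n; pose u i := mixed_diff (nseq j h) phi (y + h *+ i).
  have uS a : u a.+1 - u a = mixed_diff (nseq j.+1 h) phi (y + h *+ a).
    by rewrite /u mulrSr addrA.
  have uB a : (a <= n)%N -> `|u a| <= 2 ^+ j * B.
    move=> an; rewrite /u; apply: mixed_diff_bound => b bj; apply: phiB.
    rewrite -addrA -mulrnDr addr_ge0//= (le_trans _ yh)// lerD2l.
    by apply: hmono; rewrite leq_add// (leq_trans bj).
  have ustep a : (a < n)%N ->
      `|(u a.+2 - u a.+1) - (u a.+1 - u a)| <= dl / (2 * n%:R) * B + C * e.
    move=> an; rewrite !uS mulrSr addrA.
    apply: (H phi B e phiB phie); rewrite ?addr_ge0 ?hge0//.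
    rewrite -addrA -mulrnDr (le_trans _ yh)// lerD2l.
    by apply: hmono; rewrite -addSnnS leq_add2r.
  rewrite -uS.
  apply: le_trans (increment_bound _ (uB 0%N _) (uB n _) ustep _) _ => //.
  have -> : dl * B + n%:R * C * e = dl / 2 * B + (dl / 2 * B + n%:R * (C * e)).
    by field.
  have -> : n%:R * (dl / (2 * n%:R) * B + C * e) = dl / 2 * B + n%:R * (C * e).
    by field; rewrite pnatr_eq0.
  rewrite lerD2r.
  have -> : 2 * (2 ^+ j * B) / n%:R = 2 ^+ j.+2 / n%:R / 2 * B.
    by rewrite !exprS; field; rewrite pnatr_eq0.
  by rewrite !ler_wpM2r// ?invr_ge0// ler_pdivrMr.
(* The progression of length [n] starts at [x] if it fits to the right of [x],
   and otherwise ends at [x]. *)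
have [xn|xn] := lerP (x + h *+ (n + j.+1)) 1.
  by have := @key x 0%N x0 xn isT; rewrite addr0.
have hn' : h *+ n <= x.
  have := hmono n (n + j.+1)%N (leq_addr _ _); lra.
have := @key (x - h *+ n) n; rewrite subrK; apply => //.
  by rewrite subr_ge0.
by rewrite mulrnDr addrA subrK.
Qed.

End OneVariable.

(** * From grid nodes to the interval *)

Section NodesToInterval.
Context {R : realType}.
Implicit Types (phi : R -> R).

(** Used with the supremum as [B]; this is where the boundedness of [g]
    matters, while the bound itself leaves no trace in the conclusion. *)
Lemma bound_of_halving (T : Type) (D : set T) (g : T -> R) (K : R) :
  (exists B, forall x, D x -> `|g x| <= B) ->
  (forall B, (forall x, D x -> `|g x| <= B) ->
     forall x, D x -> `|g x| <= B / 2 + K) ->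
  forall x, D x -> `|g x| <= 2 * K.
Proof.
move=> [B gB] half x Dx.
have gsup : has_sup [set `|g y| | y in D].
  by split; [exists `|g x|, x | exists B => _ [y Dy <-]; exact: gB].
have gle y : D y -> `|g y| <= sup [set `|g y| | y in D].
  by move=> Dy; apply: ub_le_sup; [exact: gsup.2|exists y].
have : sup [set `|g y| | y in D] <= sup [set `|g y| | y in D] / 2 + K.
  by apply: ge_sup => [|_ [y Dy <-]]; [exact: gsup.1|exact: half].
have := gle _ Dx; lra.
Qed.

(** A difference of order [k] is a linear relation between [k + 1] values in
    which every coefficient has modulus at least one, so any value can be
    recovered from the others; the first and the last one serve to propagate
    bounds to the left and to the right. *)
Lemma mixed_diff_solve_term (V : zmodType) k (h : V) (f : V -> R) x i0 (A e : R) :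
  (i0 <= k)%N ->
  (forall j, (j <= k)%N -> j != i0 -> `|f (x + h *+ j)| <= A) -> 0 <= A ->
  `|mixed_diff (nseq k h) f x| <= e -> `|f (x + h *+ i0)| <= 2 ^+ k * A + e.
Proof.
move=> i0k fA A0; rewrite mixed_diff_nseqE.
have i0k' : (i0 < k.+1)%N by [].
rewrite (bigD1 (Ordinal i0k'))//=; set a := _ * f _; set b := bigop _ _ _ => abe.
have -> : (2 : R) ^+ k = \sum_(j < k.+1) 'C(k, j)%:R.
  rewrite -[2%R]/((1 + 1)%:R : R) natrD exprDn.
  by apply: eq_bigr => j _; rewrite !expr1n mulr1.
have nb : `|b| <= (\sum_(j < k.+1) 'C(k, j)%:R) * A.
  rewrite mulr_suml [leRHS](bigD1 (Ordinal i0k'))//= ler_wpDl ?mulr_ge0//.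
  rewrite (le_trans (ler_norm_sum _ _ _))// ler_sum// => j ji.
  rewrite !normrM normrX normrN1 expr1n mul1r normr_nat ler_wpM2l//.
  by apply: fA; rewrite // -ltnS.
have na : `|f (x + h *+ i0)| <= `|a|.
  rewrite /a !normrM normrX normrN1 expr1n mul1r normr_nat ler_peMl//.
  by rewrite ler1n bin_gt0.
rewrite (le_trans na)// -[a](addrK b) (le_trans (ler_normB _ _))//.
by rewrite [leRHS]addrC lerD.
Qed.

Lemma bound_on_grid k N phi (A e : R) :
  (0 < k <= N)%N -> 0 <= A -> diff_le_on01 k phi e ->
  (forall i, (i < k)%N -> `|phi ((2 * N)%:R^-1 *+ (N + i))| <= A) ->
  forall i, (i <= 2 * N)%N ->
  `|phi ((2 * N)%:R^-1 *+ i)| <= (2 ^+ k + 1) ^+ N.+1 * (A + e).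
Proof.
move=> /andP[k0 kN] A0 phie phiA; have N0 := leq_trans k0 kN; set t := _^-1.
have t0 : 0 <= t by rewrite invr_ge0.
have tN : t *+ (2 * N) = 1.
  by rewrite -mulr_natr mulVf// pnatr_eq0 -lt0n muln_gt0.
have tmono a b : (a <= b)%N -> t *+ a <= t *+ b by move=> ab; exact: ler_wpMn2l.
have tge0 a : 0 <= t *+ a by rewrite mulrn_wge0.
have dphi a : (a + k <= 2 * N)%N -> `|mixed_diff (nseq k t) phi (t *+ a)| <= e.
  by move=> ak; apply: phie => //; rewrite -mulrnDr -tN tmono.
have e0 : 0 <= e.
  have := phie 0 0 (lexx 0) (lexx 0); rewrite mul0rn addr0 => /(_ ler01).
  exact: le_trans.
pose M m : R := (2 ^+ k + 1) ^+ m * (A + e).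
have k2 : 0 <= 2 ^+ k :> R by rewrite exprn_ge0.
have b1 : 1 <= 2 ^+ k + 1 :> R by rewrite lerDr.
have M0 m : 0 <= M m by rewrite /M mulr_ge0 ?addr_ge0// exprn_ge0// addr_ge0.
have MS m : 2 ^+ k * M m + e <= M m.+1.
  rewrite /M exprS -mulrA mulrDl mul1r lerD2l.
  rewrite (@le_trans _ _ (A + e)) ?lerDr//.
  by rewrite ler_peMl ?addr_ge0// exprn_ege1.
have Mle m n : (m <= n)%N -> M m <= M n.
  by move=> mn; rewrite /M ler_wpM2r ?addr_ge0// ler_weXn2l.
have AM : A <= M 0%N by rewrite /M expr0 mul1r lerDl.
have up m i : (i < k + m)%N -> (N + i <= 2 * N)%N -> `|phi (t *+ (N + i))| <= M m.
  elim: m i => [|m IH] i.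
    by rewrite addn0 => ik _; rewrite (le_trans (phiA _ ik)).
  rewrite addnS ltnS leq_eqVlt => /orP[/eqP -> {i}|ikm] Ni; last first.
    by rewrite (le_trans (IH _ ikm Ni))// Mle.
  rewrite addnCA addnC mulrnDr.
  apply: le_trans (MS m); apply: mixed_diff_solve_term => //; last first.
    by apply: dphi; rewrite -addnA [(m + k)%N]addnC.
  move=> j jk jnk; rewrite -mulrnDr -addnA; apply: IH.
    by rewrite addnC ltn_add2r ltn_neqAle jnk.
  by rewrite (leq_trans _ Ni)// leq_add2l addnC leq_add2r.
have down m i : (m <= N)%N -> (i < k + m)%N -> (N - m + i <= 2 * N)%N ->
    `|phi (t *+ (N - m + i))| <= M m.
  elim: m i => [|m IH] i mN.
    by rewrite addn0 subn0 => ik _; rewrite (le_trans (phiA _ ik)).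
  case: i => [_ _|i]; last first.
    rewrite (addnS k) ltnS => ikm.
    rewrite (addnS (N - m.+1)) -addSn (subnSK mN) => Ni.
    by rewrite (le_trans (IH _ (ltnW mN) ikm Ni))// Mle.
  rewrite addn0 -[t *+ _]addr0 -[X in _ + X](mulr0n t).
  have Nm : (N - m.+1).+1 = (N - m)%N by rewrite subnSK.
  apply: le_trans (MS m); apply: mixed_diff_solve_term => //; last first.
    by apply: dphi; rewrite mul2n -addnn leq_add ?leq_subr.
  case=> // j jk _; rewrite -mulrnDr addnS -addSn Nm.
  apply: IH; [exact: ltnW|by rewrite (leq_trans jk)// leq_addr|].
  rewrite mul2n -addnn leq_add ?leq_subr//.
  by rewrite (leq_trans _ kN)// ltnW.
move=> i iN; have [Ni|iN'] := leqP N i.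
  rewrite -(subnKC Ni) up ?subnKC// addnS ltnS leq_subLR addnCA addnn -mul2n.
  by rewrite (leq_trans iN)// leq_addl.
have := @down N i (leqnn N); rewrite subnn add0n => /(_ _ iN) h.
rewrite (le_trans (h _)) ?(Mle N N.+1)//.
by rewrite (leq_trans iN')// leq_addl.
Qed.

(** The grid step is fixed before [phi], fine enough for first differences to
    be at most [B / 2 + C0 * e]. *)
Lemma bound_on_interval k : (0 < k)%N ->
  exists2 h0 : R, 0 < h0 & forall N, (k <= N)%N -> (2 * N)%:R^-1 <= h0 ->
  exists2 C : R, 0 <= C & forall phi (A e : R), 0 <= A ->
    (exists B, forall x, 0 <= x <= 1 -> `|phi x| <= B) ->
    diff_le_on01 k phi e ->
    (forall i, (i < k)%N -> `|phi ((2 * N)%:R^-1 *+ (N + i))| <= A) ->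
    forall x, 0 <= x <= 1 -> `|phi x| <= C * (A + e).
Proof.
move=> k0; have half0 : 0 < 2^-1 :> R by [].
have [|h0 [C0 [h00 C00 small]]] := @small_lower_diff R k k.-1 0 2^-1 _ half0.
  by rewrite add1n prednK.
exists h0 => // N kN Nh0; have N0 := leq_trans k0 kN.
exists (2 * (C0 + (2 ^+ k + 1) ^+ N.+1)) => [|phi A e A0 phiB phie phiA].
  by rewrite mulr_ge0// addr_ge0// exprn_ge0// addr_ge0// exprn_ge0.
have grid := bound_on_grid (introT andP (conj k0 kN)) A0 phie phiA.
rewrite -[2 * _ * _]mulrA; set t := _^-1 in Nh0 grid.
have t0 : 0 < t by rewrite invr_gt0 ltr0n muln_gt0.
apply: (@bound_of_halving R [set x : R | 0 <= x <= 1]) => // B phiB' x /andP[x0 x1].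
pose i := Num.truncn (x / t).
have /andP[ix xi] : i%:R <= x / t < i.+1%:R.
  by apply: truncn_itv; rewrite divr_ge0// ltW.
rewrite ler_pdivlMr// mulr_natl in ix.
rewrite ltr_pdivrMr// mulr_natl mulrSr in xi.
have iN : (i <= 2 * N)%N.
  have := le_trans ix x1; rewrite -mulr_natr -ler_pdivlMl// invrK mulr1.
  by rewrite ler_nat.
have e0 : 0 <= e.
  have := phie 0 0 (lexx 0) (lexx 0); rewrite mul0rn addr0 => /(_ ler01).
  exact: le_trans.
have h1 : `|phi x - phi (t *+ i)| <= 2^-1 * B + C0 * e.
  have := small phi B e phiB' phie (t *+ i) (x - t *+ i).
  rewrite /= mulr1n subrKC; apply => //.
  - by rewrite mulrn_wge0// ltW.
  - by rewrite subr_ge0 ix/= (le_trans _ Nh0)// lerBlDl ltW.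
have h2 := grid _ iN.
rewrite -[phi x](subrK (phi (t *+ i))) (le_trans (ler_normD _ _))//.
have -> : B / 2 = 2^-1 * B by rewrite mulrC.
have h3 : C0 * e <= C0 * (A + e) by rewrite ler_wpM2l// lerDr.
rewrite mulrDl; lra.
Qed.

End NodesToInterval.

(** * From grid nodes to the cube *)

Section NodesToCube.
Context {R : realType} {d : nat}.
Implicit Types (g : 'rV[R]_d -> R) (x : 'rV[R]_d).

Definition axis_diff_le k g (e : R) :=
  forall i x s, unit_cube x -> 0 <= s -> unit_cube (x + (s *: 'e_i) *+ k) ->
    `|mixed_diff (nseq k (s *: 'e_i)) g x| <= e.

(** Only differences along the axes enter.  The line through a point of the cube
    parallel to an axis always meets the cube in a segment of length one, to
    which [bound_on_interval] applies, whereas an oblique line may just cut off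
    a corner. *)
Lemma bound_on_cube k : (0 < k)%N ->
  exists2 h0 : R, 0 < h0 & forall N, (k <= N)%N -> (2 * N)%:R^-1 <= h0 ->
  exists2 C : R, 0 <= C & forall g (A e : R), 0 <= A -> 0 <= e ->
    (exists B, forall x, unit_cube x -> `|g x| <= B) ->
    axis_diff_le k g e ->
    (forall b : 'I_d -> nat, (forall i, (b i < k)%N) ->
       `|g (\row_i ((2 * N)%:R^-1 *+ (N + b i)))| <= A) ->
    forall x, unit_cube x -> `|g x| <= C * (A + e).
Proof.
move=> k0; have [h0 h00 H] := @bound_on_interval R k k0.
exists h0 => // N kN Nh0; have N0 := leq_trans k0 kN.
have [C1 C10 {}H] := H N kN Nh0.
set t := _^-1 in H Nh0 *.
(* The first [n] coordinates are arbitrary, the others still sit on nodes. *)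
suff S n : exists2 C : R, 0 <= C & forall g (A e : R), 0 <= A -> 0 <= e ->
    (exists B, forall x, unit_cube x -> `|g x| <= B) ->
    axis_diff_le k g e ->
    (forall b : 'I_d -> nat, (forall i, (b i < k)%N) ->
       `|g (\row_i (t *+ (N + b i)))| <= A) ->
    forall x, unit_cube x ->
      (forall i : 'I_d, (n <= i)%N -> exists2 b, (b < k)%N & x 0 i = t *+ (N + b)) ->
      `|g x| <= C * (A + e).
  have [C C0 HC] := S d; exists C => // g A e A0 e0 gB ge gA x x01.
  by apply: HC => // i; rewrite leqNgt ltn_ord.
elim: n => [|n [C C0 IH]].
  exists 1 => // g A e A0 e0 _ ge gA x x01 xN.
  have /choice[b bP] : forall i : 'I_d, exists b,
      (b < k)%N /\ x 0 i = t *+ (N + b).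
    by move=> i; have [b bk xb] := xN i (leq0n i); exists b.
  have -> : x = \row_i (t *+ (N + b i)).
    by apply/rowP => i; rewrite mxE (bP i).2.
  by rewrite mul1r (le_trans (gA b _))// ?lerDl// => i; exact: (bP i).1.
exists (C1 * (C + 1) + C) => [|g A e A0 e0 gB ge gA x x01 xN].
  by rewrite addr_ge0// mulr_ge0// addr_ge0.
have Ae0 : 0 <= A + e by rewrite addr_ge0.
have [dn|nd] := leqP d n.
  apply: (@le_trans _ _ (C * (A + e))); last first.
    by rewrite ler_wpM2r// lerDr mulr_ge0// addr_ge0.
  by apply: IH => // i /(leq_trans dn); rewrite leqNgt ltn_ord.
pose i0 := Ordinal nd.
pose L s := x + (s - x 0 i0) *: 'e_i0.
have LE s j : L s 0 j = if j == i0 then s else x 0 j.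
  rewrite /L !mxE eqxx /=; case: eqP => [->|_]; first by rewrite mulr1 subrKC.
  by rewrite mulr0 addr0.
have L01 s : 0 <= s <= 1 -> unit_cube (L s).
  by move=> s01 j; rewrite LE; case: eqP.
have -> : x = L (x 0 i0) by rewrite /L subrr scale0r addr0.
have LD y h : L (y + h) = L y + h *: 'e_i0.
  by rewrite /L addrAC scalerDl addrA.
have LDn y h m : L (y + h *+ m) = L y + (h *: 'e_i0) *+ m.
  by rewrite LD scalerMnl.
apply: (@le_trans _ _ (C1 * (C * (A + e) + e))); last first.
  by nra.
apply: (H (g \o L)) => //=.
- by rewrite mulr_ge0// addr_ge0.
- by have [B HB] := gB; exists B => s s01; apply: HB; exact: L01.
- move=> y h y0 h0' yh; rewrite (mixed_diff_comp _ _ _ LD) map_nseq.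
  apply: ge => //.
    by apply: L01; rewrite y0 (le_trans _ yh)// lerDl mulrn_wge0.
  by rewrite -LDn; apply: L01; rewrite yh addr_ge0// mulrn_wge0.
- move=> b bk; apply: IH => //.
    apply: L01; rewrite mulrn_wge0 ?invr_ge0//= /t -[X in X <= _]mulr_natr mulrC.
    rewrite ler_pdivrMr ?ltr0n ?muln_gt0//.
    by rewrite mul1r ler_nat mul2n -addnn leq_add2l (leq_trans (ltnW bk)).
  move=> j nj; rewrite LE; case: eqP => [_|/eqP ji0]; first by exists b.
  apply: xN; rewrite ltn_neqAle nj andbT eq_sym.
  by apply: contra ji0 => /eqP jn; apply/eqP/val_inj.
Qed.
End NodesToCube.

(** * Truncated Newton interpolation *)

Section NewtonInterpolation.
Context {R : realType}.

Lemma newton_forward (V : zmodType) (F : V -> R) (h x : V) K b : (b < K)%N ->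
  F (x + h *+ b) = \sum_(a < K) 'C(b, a)%:R * mixed_diff (nseq a h) F x.
Proof.
elim: b K x => [|b IH] [//|K] x bK.
  rewrite big_ord_recl bin0 mul1r mulr0n addr0 big1 ?addr0// => i _.
  by rewrite bin0n mul0r.
rewrite mulrS addrA (IH K (x + h))//.
have -> : \sum_(a < K) 'C(b, a)%:R * mixed_diff (nseq a h) F (x + h) =
  \sum_(a < K) 'C(b, a)%:R * mixed_diff (nseq a h) F x +
  \sum_(a < K) 'C(b, a)%:R * mixed_diff (nseq a.+1 h) F x.
  by rewrite -big_split; apply: eq_bigr => a _ /=; ring.
have -> : \sum_(a < K) 'C(b, a)%:R * mixed_diff (nseq a h) F x =
  \sum_(a < K.+1) 'C(b, a)%:R * mixed_diff (nseq a h) F x.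
  by rewrite [RHS]big_ord_recr/= bin_small// mul0r addr0.
rewrite big_ord_recl [RHS]big_ord_recl !bin0 -addrA; congr (_ + _).
rewrite -big_split; apply: eq_bigr => a _.
by rewrite /bump /= binS natrD; ring.
Qed.

Context {d : nat}.

Lemma msize_mul_le (p q : mpoly d R) a b :
  (msize p <= a.+1)%N -> (msize q <= b)%N -> (msize (p * q) <= a + b)%N.
Proof.
move=> pa qb; have [->|p0] := eqVneq p 0; first by rewrite mul0r msize0.
have [->|q0] := eqVneq q 0; first by rewrite mulr0 msize0.
rewrite msizeM// -ltnS prednK ?ltnS -?addSn ?leq_add//.
by rewrite ltn_addr// lt0n msize_poly_eq0.
Qed.

(** Newton's basis polynomials in one coordinate; multiplying in one factor at
    a time keeps track of the degree. *)
Lemma binomial_poly (i : 'I_d) (c t : R) a : t != 0 ->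
  exists2 m : mpoly d R, (msize m <= a.+1)%N &
    forall (b : nat) (x : 'rV[R]_d), x 0 i = c + t *+ b -> peval m x = 'C(b, a)%:R.
Proof.
move=> t0; elim: a => [|a [m ma mE]].
  by exists 1 => [|b x _]; rewrite ?msize1// bin0 /peval meval1.
pose q : mpoly d R := (a.+1%:R * t)^-1 *: mpolyX R (mnm1 i) -
  mpolyC d ((a.+1%:R * t)^-1 * c + a.+1%:R^-1 * a%:R).
exists (q * m).
  rewrite -[a.+2]add1n; apply: msize_mul_le => //.
  rewrite (leq_trans (msizeD_le _ _))// geq_max (leq_trans (msizeZ_le _ _))/=.
    by rewrite msizeN msizeC; case: eqP.
  by rewrite msizeX mdeg1.
move=> b x xb; rewrite /peval mevalM mevalB mevalZ mevalXU mevalC -/(peval m x).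
rewrite (mE _ _ xb) xb.
have aN0 : a.+1%:R != 0 :> R by rewrite pnatr_eq0.
have bin : a.+1%:R * 'C(b, a.+1)%:R = (b%:R - a%:R) * 'C(b, a)%:R :> R.
  have [ab|ba] := leqP a b; first by rewrite -natrB// -!natrM mul_bin_left.
  by rewrite !bin_small ?mulr0// ltnW.
apply: (mulfI aN0); rewrite bin -[t *+ b]mulr_natr.
by field; rewrite t0 nat1r aN0.
Qed.

(** Induction on the list of coordinates along which nodes are moved: Newton's
    formula in the direction [i] writes [F] through [Delta_i^a F], [a < k],
    and the induction hypothesis replaces each of these by a polynomial of
    degree less than [r - a].  For [a >= r] this polynomial is zero and
    the whole term is an error term, as it consists of differences with at
    least [r] steps.  The constant is chosen before the base point and the
    step, which will later scale with the cube. *)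
Lemma newton_truncated k (l : seq 'I_d) :
  exists2 C : R, 0 <= C & forall (c : 'rV[R]_d) (t : R) r (F : 'rV[R]_d -> R),
  t != 0 ->
  exists2 m : mpoly d R, (msize m <= r)%N & forall e : R, 0 <= e ->
    (forall hs : seq 'rV[R]_d, (forall h, h \in hs -> exists i, h = t *: 'e_i) ->
       (r <= size hs <= r + size l * k)%N -> `|mixed_diff hs F c| <= e) ->
    forall (b : 'I_d -> nat) (x : 'rV[R]_d), (forall i, (b i < k)%N) ->
      (forall i, i \in l -> x 0 i = c 0 i + t *+ b i) ->
      `|F (c + \sum_(i <- l) (t *: 'e_i) *+ b i) - peval m x| <= C * e.
Proof.
elim: l => [|i l [C C0 IH]].
  exists 1 => // c t [|r] F t0; [exists 0; rewrite ?msize0//|exists (mpolyC d (F c))].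
  - move=> e e0 /(_ [::]) Fe b x _ _.
    by rewrite big_nil addr0 /peval meval0 subr0 mul1r Fe.
  - by rewrite msizeC; case: eqP.
  - move=> e e0 _ b x _ _.
    by rewrite big_nil addr0 /peval mevalC subrr normr0 mul1r.
exists (\sum_(a < k) \sum_(b < k) 'C(b, a)%:R * C).
  by apply: sumr_ge0 => a _; apply: sumr_ge0 => b _; rewrite mulr_ge0.
move=> c t r F t0; pose h : 'rV[R]_d := t *: 'e_i.
have /choice[m mP] a : exists m : mpoly d R, (msize m <= r - a)%N /\
    forall e : R, 0 <= e ->
    (forall hs : seq 'rV[R]_d, (forall h, h \in hs -> exists i, h = t *: 'e_i) ->
       (r - a <= size hs <= r - a + size l * k)%N ->
       `|mixed_diff hs (mixed_diff (nseq a h) F) c| <= e) ->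
    forall (b : 'I_d -> nat) (x : 'rV[R]_d), (forall i, (b i < k)%N) ->
      (forall i, i \in l -> x 0 i = c 0 i + t *+ b i) ->
      `|mixed_diff (nseq a h) F (c + \sum_(i <- l) (t *: 'e_i) *+ b i) -
        peval m x| <= C * e.
  by have [m mr mP] := IH c t (r - a)%N (mixed_diff (nseq a h) F) t0; exists m.
have /choice[q qP] a : exists q : mpoly d R, (msize q <= a.+1)%N /\
    forall b (x : 'rV[R]_d), x 0 i = c 0 i + t *+ b -> peval q x = 'C(b, a)%:R.
  by have [q qa qE] := @binomial_poly i (c 0 i) t a t0; exists q.
exists (\sum_(a < k) q a * m a).
  rewrite (leq_trans (msize_sum _ _ _))//; apply/bigmax_leqP => a _.
  have [ra|ar] := leqP r a.
    have := (mP a).1; rewrite (eqP ra) leqn0 msize_poly_eq0 => /eqP ->.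
    by rewrite mulr0 msize0.
  by rewrite -(subnKC (ltnW ar)) msize_mul_le ?subnKC ?(qP a).1 ?(mP a).1// ltnW.
move=> e e0 Fe b x bk xb.
have xi : x 0 i = c 0 i + t *+ b i by apply: xb; rewrite mem_head.
rewrite big_cons addrCA [_ + (c + _)]addrC (newton_forward _ _ _ (bk i)).
have -> : peval (\sum_(a < k) q a * m a) x =
    \sum_(a < k) peval (q a) x * peval (m a) x.
  by rewrite /peval rmorph_sum; apply: eq_bigr => a _; exact: mevalM.
rewrite -sumrB mulr_suml (le_trans (ler_norm_sum _ _ _))//.
apply: ler_sum => a _.
rewrite ((qP a).2 _ _ xi) -mulrBr normrM normr_nat.
rewrite mulr_suml (bigD1 (Ordinal (bk i)))//= ler_wpDr ?sumr_ge0// => [j _|].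
  by rewrite !mulr_ge0.
rewrite -mulrA ler_wpM2l//.
apply: (mP a).2 => // [hs hsP /andP[hs1 hs2]|j jl]; last first.
  by apply: xb; rewrite in_cons jl orbT.
rewrite -mixed_diff_cat; apply: Fe => [g|].
  rewrite mem_cat => /orP[/hsP//|/nseqP[-> _]]; by exists i.
rewrite size_cat size_nseq /= mulSn; have := ltn_ord a; lia.
Qed.

End NewtonInterpolation.

(** * Polynomials and their differences *)

Section PolynomialsOnRowVectors.
Context {R : realType} {d : nat}.
Implicit Types (m : mpoly d R) (x h : 'rV[R]_d).

Definition degree_lt r (F : 'rV[R]_d -> R) :=
  forall k h x, (r <= k)%N -> mixed_diff (nseq k h) F x = 0.

Lemma degree_lt_coord r F i n :
  degree_lt r F -> degree_lt (n + r) (fun y => y 0 i ^+ n * F y).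
Proof.
move=> Fr; elim: n => [|n IH] k h x rk.
  by rewrite (@eq_mixed_diff _ _ _ _ F) ?Fr// => y; rewrite expr0 mul1r.
case: k rk => // k rk.
rewrite (@eq_mixed_diff _ _ _ _
  (fun y : 'rV[R]_d => y 0 i * (y 0 i ^+ n * F y))); last first.
  by move=> y; rewrite exprS mulrA.
rewrite (@mixed_diff_nseq_mul_affine _ _ _ _ (fun y : 'rV[R]_d => y 0 i) _ (h 0 i)).
  by rewrite !IH ?mulr0 ?addr0// ltnW.
by move=> y; rewrite mxE.
Qed.

(** Over an arbitrary list of indices, so that the variables can be multiplied
    in one after the other. *)
Lemma degree_lt_monomial (s : seq 'I_d) (n : 'I_d -> nat) :
  degree_lt (\sum_(i <- s) n i).+1 (fun y => \prod_(i <- s) y 0 i ^+ n i).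
Proof.
elim: s => [|i s IH] k h x.
  case: k => [|k] // _.
  have E y : mixed_diff (nseq k h)
      (fun z => \prod_(i <- [::]) z 0 i ^+ n i) y =
    mixed_diff (nseq k h) (fun=> 1) y :> R.
    by apply: eq_mixed_diff => z; rewrite big_nil.
  rewrite /= !E; elim: k {E} x => [|k IH] x /=; first by rewrite subrr.
  by rewrite !IH subrr.
rewrite big_cons -addnS => nk; rewrite -[RHS](degree_lt_coord i IH h x nk).
by apply: eq_mixed_diff => y; rewrite big_cons.
Qed.

Lemma mixed_diff_peval k m h x : (msize m <= k)%N ->
  mixed_diff (nseq k h) (peval m) x = 0.
Proof.
move=> mk; rewrite (@eq_mixed_diff _ _ _ _ _ _ (fun y : 'rV[R]_d => mevalE (y 0) m)).
rewrite mixed_diff_sum big_seq big1// => a am.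
rewrite mixed_diffZ degree_lt_monomial ?mulr0//.
by rewrite -mdegE (leq_trans (msize_mdeg_lt am)).
Qed.

(** Makes [f - m] bounded on a cube when [f] is. *)
Lemma peval_bounded m (rho : 'I_d -> R) :
  exists B, forall x, (forall i, `|x 0 i| <= rho i) -> `|peval m x| <= B.
Proof.
exists (\sum_(a <- msupp m) `|mcoeff a m| * \prod_i rho i ^+ a i) => x xr.
rewrite /peval mevalE (le_trans (ler_norm_sum _ _ _))//.
apply: ler_sum => a _; rewrite normrM ler_wpM2l// normr_prod.
apply: ler_prod => i _; rewrite normr_ge0/= normrX.
by rewrite lerXn2r// nnegrE ?(le_trans _ (xr i)).
Qed.

End PolynomialsOnRowVectors.

(** * Whitney's inequality on a cube *)

Section WhitneyInequality.
Context {R : realType} {d : nat}.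
Implicit Types (f : 'rV[R]_d -> R) (a x y h : 'rV[R]_d).

Lemma coord_le_norm x i : `|x 0 i| <= `|x|.
Proof.
by rewrite [leRHS]/Num.norm/= mx_normrE
  (le_bigmax _ (fun ij => `|x ij.1 ij.2|) (0, i)).
Qed.

Lemma norm_axis_le1 (i : 'I_d) : `|'e_i : 'rV[R]_d| <= 1.
Proof.
rewrite /Num.norm/= mx_normrE; apply: bigmax_le => // j _.
by rewrite mxE normr_nat lern1 leq_b1.
Qed.

Lemma in_cube_of_dist a (s : R) x : 0 < s ->
  `|x - (a + s *: const_mx 2^-1)| <= s / 2 ->
  [set a + s *: y | y in unit_cube] x.
Proof.
move=> s0 xa; exists (s^-1 *: (x - a)); last first.
  by rewrite scalerA divff ?gt_eqF// scale1r subrKC.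
move=> i; have := le_trans (coord_le_norm _ i) xa; rewrite !mxE.
rewrite ler_distl => /andP[h1 h2].
rewrite mulrC ler_pdivlMr// ler_pdivrMr//; apply/andP; split; lra.
Qed.

(** The grid parameter [N] has to be large for three reasons: the nodes
    must fit, [bound_on_cube] asks for a fine grid, and the mixed differences
    with up to [M] steps of size [s / (2 N)] based at the centre must stay
    inside the cube of side [s].  The value [M = k + d * k] bounds the number
    of steps that occur in [newton_truncated]. *)
Lemma whitney k : (0 < k)%N ->
  exists2 C : R, 0 <= C & forall f a (s e : R), 0 < s -> 0 <= e ->
    (exists B, forall x, unit_cube x -> `|f (a + s *: x)| <= B) ->
    (forall h x,
       (forall j, (j <= k)%N -> [set a + s *: y | y in unit_cube] (x + h *+ j)) ->
       `|mixed_diff (nseq k h) f x| <= e) ->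
    exists2 m : mpoly d R, (msize m <= k)%N &
      forall x, unit_cube x -> `|f (a + s *: x) - peval m (a + s *: x)| <= C * e.
Proof.
move=> k0; have [h0 h00 HC] := @bound_on_cube R d k k0.
pose M := (k + d * k)%N.
pose N := maxn (k.+1 * M) (Num.truncn (h0^-1)).+1.
have kN : (k <= N)%N.
  rewrite leq_max; apply/orP; left; rewrite (leq_trans (leqnSn k))// leq_pmulr//.
  by rewrite /M addn_gt0 k0.
have N0 : (0 < N)%N := leq_trans k0 kN.
have Nh0 : (2 * N)%:R^-1 <= h0.
  rewrite -[h0]invrK lef_pV2 ?posrE ?invr_gt0 ?ltr0n ?muln_gt0//.
  rewrite (le_trans (ltW (truncnS_gt _)))// ler_nat.
  by rewrite (leq_trans (leq_maxr (k.+1 * M) _))// leq_pmull.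
have [C1 C10 {}HC] := HC N kN Nh0.
set t := _^-1 in HC; have t0 : 0 < t by rewrite invr_gt0 ltr0n muln_gt0.
have tN : t *+ N = 2^-1.
  by rewrite -[LHS]mulr_natr /t natrM invfM -mulrA mulVf ?mulr1// pnatr_eq0 -lt0n.
(* The part of the argument that lives on the nodes, in the coordinates of the
   cube; the rest is carried out in those of the unit cube. *)
have [C2 C20 HN] : exists2 C : R, 0 <= C & forall f a (s e : R), 0 < s -> 0 <= e ->
    (forall h x,
       (forall j, (j <= k)%N -> [set a + s *: y | y in unit_cube] (x + h *+ j)) ->
       `|mixed_diff (nseq k h) f x| <= e) ->
    exists2 m : mpoly d R, (msize m <= k)%N &
      forall b : 'I_d -> nat, (forall i, (b i < k)%N) ->
        `|f (a + s *: \row_i (t *+ (N + b i))) -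
          peval m (a + s *: \row_i (t *+ (N + b i)))| <= C * e.
  have [C C0 HC2] := @newton_truncated R d k (enum 'I_d).
  exists (C * 2 ^+ M) => [|f a s e s0 e0 fe]; first by rewrite mulr_ge0// exprn_ge0.
  pose c := a + s *: const_mx 2^-1.
  have st0 : 0 < s * t by rewrite mulr_gt0.
  have [m mk mP] := HC2 c (s * t) k f (lt0r_neq0 st0); exists m => // b bk.
  set x := \row_i _.
  have Hb j : (\sum_(i <- enum 'I_d) ((s * t) *: 'e_i) *+ b i) 0 j =
      (s * t) *+ b j.
    rewrite big_enum/= summxE (bigD1 j)//= big1 => [|i ij].
      by rewrite addr0 scalerMnl !mxE !eqxx mulr1.
    by rewrite scalerMnl !mxE [j == i]eq_sym (negbTE ij) andbF mulr0.
  have Hx : a + s *: x = c + \sum_(i <- enum 'I_d) ((s * t) *: 'e_i) *+ b i.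
    apply/rowP => j; rewrite [RHS]mxE Hb !mxE mulrnDr tN mulrDr addrA.
    by rewrite mulrnAr.
  rewrite -mulrA {1}Hx.
  apply: mP => //; first by rewrite mulr_ge0// exprn_ge0.
    move=> hs hsP; rewrite size_enum_ord => /andP[khs hsM].
    apply: (@le_trans _ _ (2 ^+ size hs * e)); last first.
      by rewrite ler_wpM2r// ler_weXn2l// ler1n.
    apply: (@mixed_diff_le_pure _ _ k f c (s / 2)) => //.
      move=> y h yh; apply: fe => j jk; apply: in_cube_of_dist => //.
      rewrite -/c addrAC (le_trans (ler_normD _ _))// (le_trans _ yh)// lerD2l.
      by rewrite normrMn -[_ *+ j]mulr_natl ler_wpM2r// ler_nat.
    have hsn : \sum_(h <- hs) `|h| <= (s * t) *+ size hs.
      elim: hs hsP {khs hsM} => [|h hs IH] hsP; first by rewrite big_nil.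
      rewrite big_cons /= mulrS lerD ?IH// => [|g ghs]; last first.
        by apply: hsP; rewrite in_cons ghs orbT.
      have [i ->] := hsP h (mem_head _ _).
      by rewrite normrZ (gtr0_norm st0) ler_piMr ?norm_axis_le1// ltW.
    rewrite (le_trans (ler_wpM2l _ hsn))// -tN mulr_natl -mulrnA -mulrnAr.
    rewrite ler_pM2l// ler_wpMn2l// 1?ltW// (leq_trans _ (leq_maxl _ _))//.
    by rewrite mulnC leq_mul2l hsM orbT.
  by move=> i _; rewrite Hx mxE Hb.
exists (C1 * (C2 + 1)); first by rewrite mulr_ge0// addr_ge0.
move=> f a s e s0 e0 [B fB] fe; have [m mk mP] := HN f a s e s0 e0 fe.
exists m => // x x01.
pose L y := a + s *: y.
have LD y h : L (y + h) = L y + s *: h by rewrite /L scalerDr addrA.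
have LDn y h j : L (y + h *+ j) = L y + (s *: h) *+ j by rewrite LD scalerMnr.
rewrite -mulrA mulrDl mul1r.
apply: (HC (fun y => f (L y) - peval m (L y))) => //.
- by rewrite mulr_ge0.
- have [B' mB] := peval_bounded m (fun i => `|a 0 i| + s).
  exists (B + B') => y y01; rewrite (le_trans (ler_normB _ _))// lerD ?fB//.
  apply: mB => i; rewrite !mxE (le_trans (ler_normD _ _))// lerD2l.
  have /andP[y0 y1] := y01 i; rewrite normrM gtr0_norm// ger0_norm//.
  by rewrite ler_piMr// ltW.
- move=> i y u y01 u0 yk01.
  rewrite mixed_diffB !(mixed_diff_comp _ _ _ LD) map_nseq mixed_diff_peval// subr0.
  apply: fe => j jk; exists (y + (u *: 'e_i) *+ j); last by rewrite -/(L _) LDn.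
  move=> l; have /andP[y0 _] := y01 l; have /andP[_] := yk01 l.
  rewrite !scalerMnl !mxE => y1.
  have z0 : 0 <= ((0 == 0 :> 'I_1) && (l == i))%:R :> R by [].
  rewrite addr_ge0 ?mulr_ge0 ?mulrn_wge0//= (le_trans _ y1)// lerD2l.
  by rewrite ler_wpM2r// ler_wpMn2l.
Qed.
End WhitneyInequality.

(** * Comparison of the two suprema *)

Section ComparisonOnCubes.
Context {R : realType} {d : nat}.
Implicit Types (f : 'rV[R]_d -> R) (Q : set 'rV[R]_d) (k : nat).

Lemma finite_differenceE k h f x :
  finite_difference k h f x = mixed_diff (nseq k h) f x.
Proof. by rewrite mixed_diff_nseqE; apply: eq_bigr => j _; rewrite scaler_nat. Qed.

(** Subtracting any competing polynomial changes no difference of order [k]. *)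
Lemma osc_le_best_approx k f Q :
  (osc k f Q <= (2 ^+ k)%:E * best_approx k f Q)%E.
Proof.
have k2 : 0 < 2 ^+ k :> R by rewrite exprn_gt0.
rewrite -lee_pdivrMl//; apply: le_ereal_inf_tmp => _ [m mk <-].
rewrite lee_pdivrMl//; set S := ereal_sup _.
apply: ge_ereal_sup => _ [[h x]/= hxQ <-].
have HS y : Q y -> (`|f y - peval m y|%:E <= S)%E.
  by move=> Qy; apply: ereal_sup_ubound; exists y.
have Qx : Q x by have := hxQ 0%N (leq0n k); rewrite scale0r addr0.
have S0 : (0 <= S)%E by apply: le_trans (HS x Qx).
case: S S0 HS => [r|_ _|//]; last by rewrite gt0_muley ?leey// lte_fin.
rewrite lee_fin => r0 HS; rewrite lee_fin finite_differenceE.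
have -> : mixed_diff (nseq k h) f x =
    mixed_diff (nseq k h) (fun y => f y - peval m y) x.
  by rewrite mixed_diffB mixed_diff_peval// subr0.
apply: mixed_diff_bound => j jk; rewrite -lee_fin; apply: HS.
by rewrite -scaler_nat; apply: hxQ.
Qed.

Lemma is_cube_nonempty Q : is_cube Q -> Q !=set0.
Proof.
move=> [a [s [_ ->]]]; exists (a + s *: 0), 0 => //= i.
by rewrite mxE lexx ler01.
Qed.

Lemma best_approx_ge0 k f Q : Q !=set0 -> (0 <= best_approx k f Q)%E.
Proof.
move=> [x Qx]; apply: le_ereal_inf_tmp => _ [m _ <-].
by apply: ereal_sup_ge; exists `|f x - peval m x|%:E => //; exists x.
Qed.

Lemma osc_ge0 k f Q : Q !=set0 -> (0 <= osc k f Q)%E.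
Proof.
move=> [x Qx]; apply: ereal_sup_ge; exists `|finite_difference k 0 f x|%:E => //.
by exists (0, x) => //= j _; rewrite scaler0 addr0.
Qed.

Lemma best_approx_le_osc k : (0 < k)%N ->
  exists2 C : R, 0 < C & forall f Q, is_cube Q ->
    (exists B, forall x, Q x -> `|f x| <= B) ->
    (best_approx k f Q <= C%:E * osc k f Q)%E.
Proof.
move=> k0; have [C C0 HC] := @whitney R d k k0.
have C10 : 0 < C + 1 by rewrite ltr_wpDl.
(* Adding one makes the constant positive, so that the bound also holds
   in the case of infinite oscillation. *)
exists (C + 1) => // f Q cQ [B fB].
have := osc_ge0 k f (is_cube_nonempty cQ).
case Ee : (osc k f Q) => [e| |] // e0; last by rewrite gt0_muley ?leey// lte_fin.
rewrite lee_fin in e0; have [a [s [s0 QE]]] := cQ.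
have fB' : exists B, forall x, unit_cube x -> `|f (a + s *: x)| <= B.
  by exists B => x x01; apply: fB; rewrite QE; exists x.
have [|m mk mP] := HC f a s e s0 e0 fB'.
  move=> h x hx; rewrite -lee_fin -Ee -finite_differenceE.
  apply: ereal_sup_ubound; exists (h, x) => //= j jk.
  by rewrite QE scaler_nat; exact: hx.
apply: (@le_trans _ _ (ereal_sup [set `|f x - peval m x|%:E | x in Q])).
  by apply: ereal_inf_lbound; exists m.
apply: ge_ereal_sup => _ [x + <-]; rewrite QE => -[y y01 <-].
rewrite -EFinM lee_fin (le_trans (mP y y01))// ler_wpM2r// lerDl.
exact: ler01.
Qed.

Lemma packing_sup_le (p c : R) (w1 w2 : set 'rV[R]_d -> \bar R) :
  0 < p -> 0 <= c ->
  (forall Q, is_cube Q -> Q `<=` unit_cube ->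
     [/\ 0 <= w1 Q, 0 <= w2 Q & w1 Q <= c%:E * w2 Q]%E) ->
  (packing_sup p w1 <= c%:E * packing_sup p w2)%E.
Proof.
move=> p0 c0 w12; apply: ge_ereal_sup => _ [P uP <-].
have [Pfin [Pcube _] Psub] := uP.
apply: (@le_trans _ _ (c%:E * ((\sum_(Q \in P) w2 Q `^ p) `^ p^-1))%E); last first.
  by rewrite lee_wpmul2l ?lee_fin//; apply: ereal_sup_ubound; exists P.
have S0 (w : set 'rV[R]_d -> \bar R) : (0 <= \sum_(Q \in P) w Q `^ p)%E.
  by apply: fsume_ge0 => Q _; exact: poweR_ge0.
have -> : c%:E = ((c%:E `^ p) `^ p^-1)%E.
  by rewrite -poweRrM mulfV ?gt_eqF// poweRe1 ?lee_fin.
rewrite -poweRM ?poweR_ge0//; apply: gt0_ler_poweR.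
- by rewrite invr_ge0 ltW.
- by rewrite in_itv/= S0 leey.
- by rewrite in_itv/= leey andbT mule_ge0 ?S0// lee_fin powR_ge0.
rewrite !fsbig_finite// ge0_sume_distrr => [|Q _]; last exact: poweR_ge0.
rewrite big_seq [leRHS]big_seq; apply: lee_sum => Q.
rewrite in_fset_set// inE => PQ.
have [w10 w20 w1w2] := w12 Q (Pcube _ PQ) (Psub _ PQ).
rewrite -poweRM ?lee_fin//; apply: gt0_ler_poweR => //; first exact: ltW.
- by rewrite in_itv/= w10 leey.
- by rewrite in_itv/= leey andbT mule_ge0 ?lee_fin.
Qed.

Lemma locally_bounded_unit_cube f : locally_bounded f ->
  exists B, forall x, unit_cube x -> `|f x| <= B.
Proof.
have cpt : compact (@unit_cube R d).
  have := @rV_compact R d (fun=> `[0, 1]%classic)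
    (fun=> segment_compact (a := 0) (b := 1)).
  by congr compact; apply/seteqP; split => x /= xs i; have := xs i; rewrite in_itv.
move=> /(_ _ cpt) [M [_ HM]]; exists (M + 1) => x x01.
by apply: HM => //; rewrite ltrDl.
Qed.

End ComparisonOnCubes.

Theorem theorem2p8 (R : realType) (d k : nat) (hd : (0 < d)%N) (hk : (0 < k)%N) :
  exists c1 c2 : R,
    [/\ 0 < c1, 0 < c2 &
      forall (p : R) (f : 'rV[R]_d -> R),
        1 <= p -> locally_bounded f ->
        (c1%:E * variation_seminorm k p f <= packing_sup p (osc k f))%E /\
        (packing_sup p (osc k f) <= c2%:E * variation_seminorm k p f)%E].
Proof.
have [C C0 HC] := @best_approx_le_osc R d k hk.
exists C^-1, (2 ^+ k); split; rewrite ?invr_gt0 ?exprn_gt0// => p f p1 fb.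
have p0 : 0 < p by apply: lt_le_trans p1.
have [B fB] := locally_bounded_unit_cube fb.
split.
  rewrite lee_pdivrMl//; apply: packing_sup_le => // [|Q cQ Qsub].
    exact: ltW.
  have Q0 := is_cube_nonempty cQ; split; [exact: best_approx_ge0|exact: osc_ge0|].
  by apply: HC => //; exists B => x Qx; apply: fB; exact: Qsub.
apply: packing_sup_le => // Q cQ _.
have Q0 := is_cube_nonempty cQ; split; [exact: osc_ge0|exact: best_approx_ge0|].
exact: osc_le_best_approx.
Qed.
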